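(* Let $\psi: T \to \mathbb{C}$ be a function and $\varphi: T \to T$ a self-map. If $W_{\psi,\varphi}$ is bounded on $L_\mu^0$, then $W_{\psi,\varphi}$ is bounded on $L_\mu^\infty$.
   Context: $(T,\mathrm{d})$ is a metric space with a distinguished point $o$ (the root); the length of $v \in T$ is $|v| = \mathrm{d}(o,v)$. $T$ is assumed locally finite (for every $M>0$ the set $\{v \in T : |v| < M\}$ is finite) and unbounded (for every $M>0$ there is $v \in T$ with $|v| \ge M$). $\mu: T \to (0,\infty)$ is an arbitrary positive function (a weight). $L_\mu^\infty$ is the Banach space of functions $f: T \to \mathbb{C}$ with $\|f\|_\mu = \sup_{v \in T} \mu(v)|f(v)| < \infty$, and $L_\mu^0$ is its closed subspace of those $f$ with $\lim_{|v|\to\infty} \mu(v)|f(v)| = 0$. The weighted composition operator is the linear map $W_{\psi,\varphi} f = \psi\,(f\circ\varphi)$; it is bounded on a space if it is a bounded operator from that space to itself. *)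

(* Defs.v *)
From HB Require Import structures.
From mathcomp Require Import all_boot all_order all_algebra.
From mathcomp Require Import complex.
From mathcomp Require Import all_classical all_reals all_analysis.

Set Implicit Arguments.
Unset Strict Implicit.
Unset Printing Implicit Defensive.

Import Order.TTheory GRing.Theory Num.Theory.
Import numFieldNormedType.Exports.
Import ComplexField.

Local Open Scope classical_set_scope.
Local Open Scope ring_scope.

Definition locally_finite (R : realType) (T : metricType R) (o : T) : Prop :=
  forall M : R, 0 < M -> finite_set [set v : T | mdist o v < M].

Definition unbounded (R : realType) (T : metricType R) (o : T) : Prop :=
  forall M : R, 0 < M -> exists v : T, M <= mdist o v.

(* The filter of the limits "as |v| -> oo", where |v| = mdist o v. *)
Definition length_infty (R : realType) (T : metricType R) (o : T) :
    set_system T :=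
  filter_from [set: R] (fun M => [set v : T | M <= mdist o v]).

Global Instance length_infty_filter (R : realType) (T : metricType R) (o : T) :
  Filter (length_infty o).
Proof.
apply: filter_from_filter; first by exists 0.
move=> M N _ _; exists (Num.max M N) => // v /=.
by rewrite ge_max => /andP[].
Qed.

Section weighted_spaces.
Variables (R : realType) (T : metricType R).
Implicit Types (o : T) (mu : T -> R) (f : T -> R[i]).

Definition weighted_abs mu f : T -> R := fun v => mu v * Normc.normc (f v).

(* Extended-real valued, so that it is the honest supremum for every f. *)
Definition weighted_norm mu f : \bar R :=
  ereal_sup (range (fun v => (weighted_abs mu f v)%:E)).

Definition Lmu_infty mu : set (T -> R[i]) :=
  [set f | (weighted_norm mu f < +oo)%E].

Definition Lmu_0 o mu : set (T -> R[i]) :=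
  [set f | Lmu_infty mu f /\ weighted_abs mu f @ length_infty o --> (0 : R)].

Definition bounded_operator_on mu (X : set (T -> R[i]))
    (A : {linear (T -> R[i]) -> (T -> R[i])}) : Prop :=
  (forall f, X f -> X (A f)) /\
  exists C : R, forall f, X f ->
    (weighted_norm mu (A f) <= C%:E * weighted_norm mu f)%E.

End weighted_spaces.

Section weighted_composition.
Variables (R : realType) (T : metricType R).

Definition weighted_comp (psi : T -> R[i]) (phi : T -> T)
    (f : T -> R[i]) : T -> R[i] :=
  fun v => psi v * f (phi v).

Lemma weighted_comp_is_linear (psi : T -> R[i]) (phi : T -> T) :
  linear (weighted_comp psi phi).
Proof.
move=> a f g; apply/funext => v.
change (psi v * (a * f (phi v) + g (phi v))
        = a * (psi v * f (phi v)) + psi v * g (phi v)).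
by rewrite mulrDr mulrCA.
Qed.

HB.instance Definition _ (psi : T -> R[i]) (phi : T -> T) :=
  GRing.isLinear.Build R[i] (T -> R[i]) (T -> R[i]) *:%R
    (weighted_comp psi phi) (weighted_comp_is_linear psi phi).

End weighted_composition.

(* Main.v *)
(** The indicator of a single vertex [phi v] lies in L_mu^0 and has norm
    [mu (phi v)], so boundedness on L_mu^0 with constant [C] gives
    [mu v * |psi v| <= C * mu (phi v)] at every [v], and this pointwise bound
    is enough for boundedness on L_mu^infty, with the same [C]. *)
Require Import Defs.
From HB Require Import structures.
From mathcomp Require Import all_boot all_order all_algebra.
From mathcomp Require Import complex.
From mathcomp Require Import all_classical all_reals all_analysis.

Set Implicit Arguments.
Unset Strict Implicit.
Unset Printing Implicit Defensive.

Import Order.TTheory GRing.Theory Num.Theory.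
Import numFieldNormedType.Exports.

Local Open Scope classical_set_scope.
Local Open Scope ring_scope.

Lemma normc_ge0 (R : rcfType) (z : R[i]) : 0 <= Normc.normc z.
Proof. by case: z => a b; rewrite sqrtr_ge0. Qed.

Section weighted_spaces.
Variables (R : realType) (T : metricType R) (mu : T -> R).
Hypothesis mu_gt0 : forall v, 0 < mu v.
Implicit Types (f : T -> R[i]) (v w : T).

Lemma weighted_abs_le_norm f v :
  ((weighted_abs mu f v)%:E <= weighted_norm mu f)%E.
Proof. by apply: ereal_sup_ubound; exists v. Qed.

Definition indicator_at w : T -> R[i] := fun v => (v == w)%:R.

Lemma weighted_abs_indicator_at w v :
  weighted_abs mu (indicator_at w) v = mu w * (v == w)%:R.
Proof.
rewrite /weighted_abs /indicator_at.
by have [->|_] := eqVneq v w; rewrite ?Normc.normc1 ?Normc.normc0 ?mulr0.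
Qed.

Lemma weighted_norm_indicator_at_le w :
  (weighted_norm mu (indicator_at w) <= (mu w)%:E)%E.
Proof.
apply: ge_ereal_sup => _ [v _ <-].
rewrite weighted_abs_indicator_at lee_fin.
by case: eqP => _; rewrite ?mulr1// mulr0 ltW.
Qed.

(** The support is the single vertex [w], so the weighted modulus is eventually zero along
    [length_infty o]. *)
Lemma indicator_at_in_Lmu_0 o w : Lmu_0 o mu (indicator_at w).
Proof.
split; first exact: le_lt_trans (weighted_norm_indicator_at_le w) (ltry _).
(* The sets generating the filter are given by a non-strict inequality: the radius [mdist o w] would
   still admit [w], and adding 1 excludes it. *)
apply: cvg_near_cst; exists (mdist o w + 1) => // v /= far.
rewrite weighted_abs_indicator_at.
have [vw|_] := eqVneq v w; last by rewrite mulr0.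
by move: far; rewrite vw leNgt ltrDl ltr01.
Qed.

End weighted_spaces.

Theorem lemma3p5 (R : realType) (T : metricType R) (o : T)
    (T_locally_finite : locally_finite o) (T_unbounded : unbounded o)
    (mu : T -> R) (mu_gt0 : forall v : T, 0 < mu v)
    (psi : T -> R[i]) (phi : T -> T) :
  bounded_operator_on mu (Lmu_0 o mu) (weighted_comp psi phi) ->
  bounded_operator_on mu (Lmu_infty mu) (weighted_comp psi phi).
Proof.
move=> [_ [C normW]].
have psi_le v : mu v * Normc.normc (psi v) <= C * mu (phi v).
  have := normW _ (indicator_at_in_Lmu_0 mu_gt0 o (phi v)).
  (* Evaluated at [v], the image of [indicator_at (phi v)] is exactly [psi v]. *)
  move=> /(le_trans (weighted_abs_le_norm mu _ v)).
  rewrite /weighted_abs /= /weighted_comp /indicator_at /= eqxx mulr1.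
  move=> psi_le_norm.
  (* The sign of [C] is not yet known, so an upper bound on the norm could not be multiplied by [C];
     the exact value is established instead. *)
  have norm_ge : ((mu (phi v))%:E <= weighted_norm mu (indicator_at (phi v)))%E.
    apply: le_trans (weighted_abs_le_norm mu _ (phi v)).
    by rewrite weighted_abs_indicator_at eqxx mulr1.
  rewrite -lee_fin EFinM; apply: le_trans psi_le_norm _.
  suff -> : weighted_norm mu (indicator_at (phi v)) = (mu (phi v))%:E by [].
  by apply/eqP; rewrite eq_le weighted_norm_indicator_at_le.
(* The pointwise bound at one vertex forces the sign, since [mu] is positive; [o] serves as that
   vertex. *)
have C_ge0 : 0 <= C.
  rewrite -(pmulr_lge0 _ (mu_gt0 (phi o))); apply: le_trans (psi_le o).
  by rewrite mulr_ge0 ?normc_ge0// ltW.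
have normW_le f : (weighted_norm mu (weighted_comp psi phi f)
    <= C%:E * weighted_norm mu f)%E.
  apply: ge_ereal_sup => _ [v _ <-].
  (* This intermediate value arises from multiplying [psi_le v] by the modulus of [f (phi v)]. *)
  apply: (@le_trans _ _ (C%:E * (weighted_abs mu f (phi v))%:E)%E).
    rewrite -EFinM lee_fin /weighted_abs /weighted_comp Normc.normcM !mulrA.
    by rewrite ler_wpM2r ?normc_ge0.
  by apply: lee_wpmul2l; [rewrite lee_fin | exact: weighted_abs_le_norm].
split=> [f f_bounded|]; last by exists C => f _; exact: normW_le.
apply: le_lt_trans (normW_le f) _.
exact: lte_mul_pinfty.
Qed.
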